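(* Let $\Omega$ be a set with $|\Omega|>1$. Then the free inverse monoid $\mathrm{FIM}(\Omega)$ and the free ample monoid $\mathrm{FAM}(\Omega)$ are neither left nor right coherent. The free left ample monoid $\mathrm{FLA}(\Omega)$ is right coherent, but not left coherent.
   Context: Monoids: let $\mathrm{FG}(\Omega)$ be the free group on $\Omega$, its elements regarded as reduced words over $\Omega\cup\Omega^{-1}$, and let $\Omega^*\subseteq \mathrm{FG}(\Omega)$ be the free monoid, with empty word $\epsilon$. A subset $A\subseteq\mathrm{FG}(\Omega)$ is prefix closed if every prefix of (the reduced word of) every element of $A$ lies in $A$. Then $\mathrm{FIM}(\Omega)=\{(A,a): A\subseteq \mathrm{FG}(\Omega)\text{ finite and prefix closed},\ a\in A\}$, with product $(A,a)(B,b)=(A\cup aB,ab)$ and identity $(\{\epsilon\},\epsilon)$. Its submonoids $\mathrm{FAM}(\Omega)$ and $\mathrm{FLA}(\Omega)$ are $\mathrm{FAM}(\Omega)=\{(A,a)\in\mathrm{FIM}(\Omega): a\in\Omega^*\}$ and $\mathrm{FLA}(\Omega)=\{(A,a)\in \mathrm{FIM}(\Omega): A\subseteq\Omega^*\}$. Coherency: for a monoid $S$, a right $S$-act is a set $A$ with a map $A\times S\to A$, $(a,s)\mapsto as$, such that $a1=a$ and $a(st)=(as)t$ for all $a\in A$, $s,t\in S$ (the empty act is allowed). A right $S$-act is finitely presented if it is isomorphic to a quotient of a finitely generated free right $S$-act by a finitely generated congruence. The monoid $S$ is right coherent if every finitely generated subact of every finitely presented right $S$-act is finitely presented. Left coherency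 is defined dually, using left $S$-acts. *)

(* Defs.v *)
From HB Require Import structures.
From mathcomp Require Import all_boot finmap.
From mathcomp Require Import boolp classical_sets functions cardinality.

Set Implicit Arguments.
Unset Strict Implicit.
Unset Printing Implicit Defensive.

Local Open Scope group_scope.

Section FreeGroup.
Variable Omega : Type.

(* (x, true) is the letter x and (x, false) its formal inverse; {classic Omega}
   is Omega with its classical choiceType structure. *)
Definition letter := ({classic Omega} * bool)%type.

Definition inv_letter (l : letter) : letter := (l.1, ~~ l.2).

Definition reduced (w : seq letter) : bool :=
  sorted (fun l l' => l' != inv_letter l) w.

Record FG := MkFG { word :> seq letter; word_reduced : reduced word }.
HB.instance Definition _ := [isSub for word].
HB.instance Definition _ := [Choice of FG by <:].

(* Left multiplication of a reduced word by a letter, with cancellation. *)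
Definition push (l : letter) (w : seq letter) : seq letter :=
  if w is l' :: w' then if l' == inv_letter l then w' else l :: w else [:: l].

Definition mul_word (u v : seq letter) : seq letter := foldr push v u.
Definition inv_word (u : seq letter) : seq letter := rev (map inv_letter u).

Lemma inv_letterK : involutive inv_letter.
Proof. by case=> x b; rewrite /inv_letter /= negbK. Qed.

Lemma reduced_behead l w : reduced (l :: w) -> reduced w.
Proof. exact: path_sorted. Qed.

Lemma push_reduced l w : reduced w -> reduced (push l w).
Proof.
case: w => [|l' w] //= rw.
case: eqVneq => [_|nl]; first exact: reduced_behead rw.
by rewrite /reduced /= nl.
Qed.

Lemma push_cons l w : reduced (l :: w) -> push l w = l :: w.
Proof. by case: w => //= l' w /andP[/negPf->]. Qed.

Lemma pushK l w : reduced w -> push l (push (inv_letter l) w) = w.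
Proof.
case: w => [|l' w] rw; first by rewrite /= eqxx.
rewrite /= inv_letterK; case: eqVneq => [el|_] /=; last by rewrite eqxx.
by rewrite -el push_cons.
Qed.

Lemma mul_word_reduced u v : reduced v -> reduced (mul_word u v).
Proof. by move=> rv; elim: u => //= l u IH; apply: push_reduced. Qed.

Lemma mul_word1 u : reduced u -> mul_word u [::] = u.
Proof.
elim: u => //= l u IH ru.
by rewrite IH ?push_cons //; apply: reduced_behead ru.
Qed.

Lemma mul_word_push l v w : reduced w ->
  mul_word (push l v) w = push l (mul_word v w).
Proof.
move=> rw; case: v => [|l' v] //=; case: eqVneq => [->|//].
by rewrite pushK //; apply: mul_word_reduced.
Qed.

Lemma mul_wordA u v w : reduced w ->
  mul_word u (mul_word v w) = mul_word (mul_word u v) w.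
Proof. by move=> rw; elim: u => //= l u ->; rewrite mul_word_push. Qed.

Lemma inv_word_reduced u : reduced u -> reduced (inv_word u).
Proof.
rewrite /reduced rev_sorted sorted_map; apply: sub_sorted => l l' /=.
by apply: contraNneq => ->; rewrite inv_letterK.
Qed.

Lemma inv_wordK u : reduced u -> mul_word u (inv_word u) = [::].
Proof.
elim: u => //= l u IH ru; have ru' := reduced_behead ru.
have mcat x y z : mul_word (x ++ y) z = mul_word x (mul_word y z).
  by rewrite /mul_word foldr_cat.
have -> : inv_word (l :: u) = mul_word (inv_word u) [:: inv_letter l].
  rewrite -[LHS]mul_word1; last exact: inv_word_reduced.
  by rewrite /inv_word /= rev_cons -cats1 mcat.
by rewrite mul_wordA // IH //= eqxx.
Qed.

Definition fg_one : FG := @MkFG [::] isT.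
Definition fg_mul (a b : FG) : FG :=
  MkFG (mul_word_reduced a (word_reduced b)).
Definition fg_inv (a : FG) : FG := MkFG (inv_word_reduced (word_reduced a)).

Lemma fg_mulA : associative fg_mul.
Proof. by move=> a b c; apply/val_inj/mul_wordA/word_reduced. Qed.
Lemma fg_mul1 : left_id fg_one fg_mul.
Proof. by move=> a; apply/val_inj. Qed.
Lemma fg_mulg1 : right_id fg_one fg_mul.
Proof. by move=> a; apply/val_inj/mul_word1/word_reduced. Qed.
Lemma fg_mulgV : right_inverse fg_one fg_inv fg_mul.
Proof. by move=> a; apply/val_inj/inv_wordK/word_reduced. Qed.
Lemma fg_mulVg : left_inverse fg_one fg_inv fg_mul.
Proof.
move=> a; rewrite -[LHS]fg_mulg1 -(fg_mulgV (fg_inv a)).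
rewrite fg_mulA -(fg_mulA (fg_inv a)) fg_mulgV fg_mulg1.
by rewrite fg_mulgV.
Qed.

HB.instance Definition _ := isGroup.Build FG
  fg_mulA fg_mul1 fg_mulg1 fg_mulVg fg_mulgV.

(* The free monoid Omega^* inside the free group. *)
Definition positive (a : FG) : bool := all (fun l : letter => l.2) a.

Lemma positive1 : positive 1. Proof. by []. Qed.

Lemma positiveM a b : positive a -> positive b -> positive (a * b).
Proof.
rewrite /positive /= => pa pb; elim: (word a) pa => //= l u IH /andP[pl pu].
move: (IH pu); case: (mul_word u b) => [|l' m] /=; first by rewrite pl.
by case: ifP => _ /andP[pl' pm]; rewrite //= pl pl'.
Qed.

Definition prefix_closed (A : {fset FG}) : bool :=
  `[< forall u v : FG, prefix u v -> v \in A -> u \in A >].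

End FreeGroup.

Arguments positive {Omega}.
Arguments prefix_closed {Omega}.

Section FreeInverseMonoid.
Variable Omega : Type.
Local Notation FG := (FG Omega).

Definition in_FIM (p : {fset FG} * FG) : bool :=
  prefix_closed p.1 && (p.2 \in p.1).

Record FIM := MkFIM { fim_pair :> {fset FG} * FG; fim_pairP : in_FIM fim_pair }.
HB.instance Definition _ := [isSub for fim_pair].
HB.instance Definition _ := [Choice of FIM by <:].

Definition fim_mul_pair (p q : {fset FG} * FG) : {fset FG} * FG :=
  ((p.1 `|` [fset p.2 * b | b in q.1])%fset, p.2 * q.2).

Lemma prefix_mul_word (u a b : seq (letter Omega)) : reduced a -> reduced b ->
  prefix u (mul_word a b) ->
  prefix u a \/ exists2 q, prefix q b & u = mul_word a q.
Proof.
move=> ra rb; elim: a u ra => [|l a IH] u /= ra; first by right; exists u.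
have ra' := reduced_behead ra.
have rm : reduced (mul_word a b) by apply: mul_word_reduced.
case em: (mul_word a b) rm => [|l' m] rm.
  case: u => [|l1 u] /=; first by left.
  case/andP=> /eqP->; case: u => // _.
  by left; rewrite eqxx prefix0s.
rewrite /=; case: eqVneq => [el|nl].
- move=> pu; have /(IH _ ra') : prefix (l' :: u) (mul_word a b).
    by rewrite em /= eqxx.
  case=> [pa|[q pq eq]].
    case: a ra {IH ra' em} pa => //= l1 a /andP[nl _] /andP[/eqP e1 _].
    by rewrite -e1 el eqxx in nl.
  by right; exists q => //; rewrite -eq /= el eqxx.
- case: u => [|l1 u] /=; first by left.
  case/andP=> /eqP-> pu; have /(IH _ ra') : prefix u (mul_word a b).
    by rewrite em.
  case=> [pa|[q pq eq]]; first by left; rewrite eqxx.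
  right; exists q => //; rewrite -eq.
  by case: u pu {eq} => //= l2 u /andP[/eqP-> _]; rewrite (negPf nl).
Qed.

Lemma prefix_reduced (u v : seq (letter Omega)) :
  prefix u v -> reduced v -> reduced u.
Proof.
case/prefixP=> w ->; rewrite /reduced.
by case: u => //= l u; rewrite cat_path => /andP[].
Qed.

Lemma in_FIM_mul p q : in_FIM p -> in_FIM q -> in_FIM (fim_mul_pair p q).
Proof.
case: p q => [A a] [B b] /andP[/asboolP/= cA aA] /andP[/asboolP/= cB bB].
apply/andP; split; last first.
  by rewrite /= inE; apply/orP; right; apply/imfsetP; exists b.
apply/asboolP => u v puv /=; rewrite !inE => /orP[vA|/imfsetP[c /= cB' ev]].
  by rewrite (cA _ _ puv).
apply/orP; move: puv; rewrite ev => puv.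
case: (prefix_mul_word (word_reduced a) (word_reduced c) puv).
  by move=> /cA; left; auto.
case=> q pq eu; right; apply/imfsetP.
exists (MkFG (prefix_reduced pq (word_reduced c))) => /=; first exact: (cB _ c).
exact: val_inj.
Qed.

Lemma in_FIM_one : in_FIM ([fset 1]%fset, 1).
Proof.
rewrite /in_FIM /= inE eqxx andbT; apply/asboolP => u v puv.
rewrite !inE => /eqP ev; move: puv; rewrite ev prefixs0 => /eqP eu.
by apply/eqP/val_inj.
Qed.

Definition fim_one : FIM := MkFIM in_FIM_one.
Definition fim_mul (p q : FIM) : FIM :=
  MkFIM (in_FIM_mul (fim_pairP p) (fim_pairP q)).

Lemma fim_mulA : associative fim_mul.
Proof.
move=> [[A a] hA] [[B b] hB] [[C c] hC]; apply/val_inj; congr pair => /=;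
  last exact: mulgA.
apply/fsetP => x; rewrite !inE -orbA; congr orb; apply/imfsetP/orP => /=.
- case=> y; rewrite inE => /orP[yB ->|/imfsetP[z /= zC -> ->]].
    by left; apply/imfsetP; exists y.
  by right; apply/imfsetP; exists z => //; rewrite mulgA.
- case=> /imfsetP[z /= zC ->]; first by exists z; rewrite // inE zC.
  exists (b * z); last by rewrite mulgA.
  by rewrite inE; apply/orP; right; apply/imfsetP; exists z.
Qed.

Lemma prefix_closed1 (A : {fset FG}) a : prefix_closed A -> a \in A -> 1 \in A.
Proof. by move=> /asboolP cA; apply: cA; apply: prefix0s. Qed.

Lemma fim_mul1 : left_id fim_one fim_mul.
Proof.
move=> [[A a] hA]; apply/val_inj; congr pair => /=; last exact: mul1g.
case/andP: (hA) => cA aA; apply/fsetP => x; rewrite !inE.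
apply/orP/idP => [[/eqP->|/imfsetP[y /= yA ->]]|xA].
- exact: prefix_closed1 aA.
- by rewrite mul1g.
- by right; apply/imfsetP; exists x; rewrite // mul1g.
Qed.

Lemma fim_mulg1 : right_id fim_one fim_mul.
Proof.
move=> [[A a] hA]; apply/val_inj; congr pair => /=; last exact: mulg1.
case/andP: (hA) => /= cA aA; apply/fsetP => x; rewrite !inE.
apply/orP/idP => [[//|/imfsetP[y /=]]|xA]; last by left.
by rewrite inE => /eqP-> ->; rewrite mulg1.
Qed.

HB.instance Definition _ := isMonoid.Build FIM fim_mulA fim_mul1 fim_mulg1.

Definition in_FAM : {pred FIM} := fun p => positive p.2.
Definition in_FLA : {pred FIM} := fun p => all positive p.1.

Lemma in_FAM_closed : umagma_closed in_FAM.
Proof. by split=> // p q; rewrite !unfold_in /=; exact: positiveM. Qed.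

Lemma in_FLA_closed : umagma_closed in_FLA.
Proof.
split=> [|p q]; rewrite !unfold_in /=.
  by apply/allP => x; rewrite inE => /eqP->.
move=> /allP hp /allP hq; apply/allP => x; rewrite inE => /orP[/hp //|].
case/imfsetP => y /= yq ->; apply: positiveM; last exact: hq.
by apply: hp; case/andP: (fim_pairP p).
Qed.

Record FAM := MkFAM { fam_val :> FIM; fam_valP : in_FAM fam_val }.
HB.instance Definition _ := [isSub for fam_val].
HB.instance Definition _ := [Choice of FAM by <:].
HB.instance Definition _ := SubChoice_isSubMonoid.Build _ _ FAM in_FAM_closed.

Record FLA := MkFLA { fla_val :> FIM; fla_valP : in_FLA fla_val }.
HB.instance Definition _ := [isSub for fla_val].
HB.instance Definition _ := [Choice of FLA by <:].
HB.instance Definition _ := SubChoice_isSubMonoid.Build _ _ FLA in_FLA_closed.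

End FreeInverseMonoid.

(* The carrier of an act may be empty. *)
Record ract (S : monoidType) := RAct {
  ract_car :> Type;
  actr : ract_car -> S -> ract_car;
  actr1 : forall a, actr a 1 = a;
  actrM : forall a s t, actr a (s * t) = actr (actr a s) t
}.

Definition act_hom (S : monoidType) (A B : ract S) (f : A -> B) : Prop :=
  forall a s, f (actr a s) = actr (f a) s.

Definition act_isomorphic (S : monoidType) (A B : ract S) : Prop :=
  exists2 f : A -> B, act_hom f & bijective f.

Record is_congruence (S : monoidType) (A : ract S) (rho : A -> A -> Prop)
    : Prop := {
  cong_refl : forall a, rho a a;
  cong_sym : forall a b, rho a b -> rho b a;
  cong_trans : forall a b c, rho a b -> rho b c -> rho a c;
  cong_act : forall a b s, rho a b -> rho (actr a s) (actr b s)
}.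

Record congruence (S : monoidType) (A : ract S) := Congruence {
  cong_rel :> A -> A -> Prop;
  congP : is_congruence cong_rel
}.

Definition cong_gen (S : monoidType) (A : ract S) (H : set (A * A))
    : A -> A -> Prop :=
  fun a b => forall rho : congruence A,
    (forall c d, H (c, d) -> rho c d) -> rho a b.

Definition cong_fg (S : monoidType) (A : ract S) (rho : congruence A) : Prop :=
  exists2 H : set (A * A), finite_set H &
    forall a b, rho a b <-> cong_gen H a b.

Section Quotient.
Variables (S : monoidType) (A : ract S) (rho : congruence A).
Local Open Scope classical_set_scope.

Definition cong_class (a : A) : set A := [set b | rho a b].
Definition quot_car : Type := {C : set A | exists a, C = cong_class a}.

Lemma cong_classP a b : rho a b -> cong_class a = cong_class b.
Proof.
have [_ sy tr _] := congP rho; move=> rab; apply/seteqP; split=> c /= h.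
  by apply: tr h; apply: sy.
exact: tr h.
Qed.

Lemma quot_act_subproof (C : quot_car) (s : S) :
  exists a, [set b | exists2 c, proj1_sig C c & rho (actr c s) b] = cong_class a.
Proof.
case: C => C /= [a ->]; exists (actr a s).
have [re sy tr ac] := congP rho.
apply/seteqP; split=> [b [c rac rb]|b rb]; last by exists a => //; apply: re.
by apply: tr rb; apply: ac.
Qed.

Definition quot_actr (C : quot_car) (s : S) : quot_car :=
  exist _ _ (quot_act_subproof C s).

Definition quot_proj (a : A) : quot_car :=
  exist _ (cong_class a) (ex_intro _ a erefl).

Lemma quot_eq (C D : quot_car) : proj1_sig C = proj1_sig D -> C = D.
Proof.
case: C D => [C hC] [D hD] /= e; subst D.
by congr exist; apply: Prop_irrelevance.
Qed.

Lemma quot_projE (C : quot_car) : exists a, C = quot_proj a.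
Proof. by case: C => C [a ea]; exists a; apply: quot_eq. Qed.

Lemma quot_actrE a s : quot_actr (quot_proj a) s = quot_proj (actr a s).
Proof.
have [re sy tr ac] := congP rho; apply: quot_eq => /=.
apply/seteqP; split=> [b [c rac rb]|b rb]; last by exists a => //; apply: re.
by apply: tr rb; apply: ac.
Qed.

Lemma quot_actr1 C : quot_actr C 1 = C.
Proof. by have [a ->] := quot_projE C; rewrite quot_actrE actr1. Qed.

Lemma quot_actrM C s t : quot_actr C (s * t) = quot_actr (quot_actr C s) t.
Proof. by have [a ->] := quot_projE C; rewrite !quot_actrE actrM. Qed.

Definition quot_act : ract S := RAct quot_actr1 quot_actrM.

End Quotient.

Section FreeAct.
Variables (S : monoidType) (X : Type).

Definition free_actr (p : X * S) (s : S) : X * S := (p.1, p.2 * s).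
Lemma free_actr1 p : free_actr p 1 = p.
Proof. by case: p => x u; rewrite /free_actr mulg1. Qed.
Lemma free_actrM p s t : free_actr p (s * t) = free_actr (free_actr p s) t.
Proof. by rewrite /free_actr /= mulgA. Qed.

Definition free_act : ract S := RAct free_actr1 free_actrM.

End FreeAct.

Definition finitely_presented (S : monoidType) (A : ract S) : Prop :=
  exists (n : nat) (rho : congruence (free_act S 'I_n)),
    cong_fg rho /\ act_isomorphic A (quot_act rho).

Record subact (S : monoidType) (A : ract S) := SubAct {
  subact_set : set A;
  subact_closed : forall a s, subact_set a -> subact_set (actr a s)
}.

Definition subact_fg (S : monoidType) (A : ract S) (B : subact A) : Prop :=
  exists2 X : set A, finite_set X &
    forall b, subact_set B b <-> exists x s, X x /\ b = actr x s.

Section SubactAsAct.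
Variables (S : monoidType) (A : ract S) (B : subact A).

Definition sub_actr (b : {a : A | subact_set B a}) (s : S) : {a : A | subact_set B a} :=
  exist _ (actr (proj1_sig b) s) (subact_closed s (proj2_sig b)).

Lemma sub_eq (b c : {a : A | subact_set B a}) : proj1_sig b = proj1_sig c -> b = c.
Proof.
case: b c => [b hb] [c hc] /= e; subst c.
by congr exist; apply: Prop_irrelevance.
Qed.

Lemma sub_actr1 b : sub_actr b 1 = b.
Proof. by apply: sub_eq; apply: actr1. Qed.
Lemma sub_actrM b s t : sub_actr b (s * t) = sub_actr (sub_actr b s) t.
Proof. by apply: sub_eq; apply: actrM. Qed.

Definition act_of_subact : ract S := RAct sub_actr1 sub_actrM.

End SubactAsAct.

Definition right_coherent (S : monoidType) : Prop :=
  forall A : ract S, finitely_presented A ->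
  forall B : subact A, subact_fg B -> finitely_presented (act_of_subact B).

Definition opposite (S : Type) : Type := S.

Section Opposite.
Variable S : monoidType.

HB.instance Definition _ := Choice.on (opposite S).

Definition opp_mul (s t : opposite S) : opposite S := (t : S) * (s : S).

Lemma opp_mulA : associative opp_mul.
Proof. by move=> s t u; rewrite /opp_mul mulgA. Qed.
Lemma opp_mul1 : left_id (1 : S) opp_mul.
Proof. by move=> s; rewrite /opp_mul mulg1. Qed.
Lemma opp_mulg1 : right_id (1 : S) opp_mul.
Proof. by move=> s; rewrite /opp_mul mul1g. Qed.

HB.instance Definition _ :=
  isMonoid.Build (opposite S) opp_mulA opp_mul1 opp_mulg1.

End Opposite.

(* A left S-act is a right act over the opposite monoid, read through actl;
   homomorphisms, congruences, free acts and subacts are then the left ones. *)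
Definition lact (S : monoidType) := ract (opposite S).

Definition actl (S : monoidType) (A : lact S) (s : S) (a : A) : A :=
  actr a (s : opposite S).

Lemma act1l (S : monoidType) (A : lact S) (a : A) : actl 1 a = a.
Proof. exact: actr1. Qed.

Lemma actMl (S : monoidType) (A : lact S) (s t : S) (a : A) :
  actl (s * t) a = actl s (actl t a).
Proof. exact: (actrM a (t : opposite S) (s : opposite S)). Qed.

Definition left_coherent (S : monoidType) : Prop :=
  forall A : lact S, finitely_presented A ->
  forall B : subact A, subact_fg B -> finitely_presented (act_of_subact B).

(* Main.v *)
(* Negative half. The act is <a, b | a f = b f, b x = b>, with f an idempotent
   recording the edge y and x moving along the edge x. Passing from a to b needs
   a y-edge at the current position; at b one may slide along x, at the price of
   blurring the ray of powers of x. So an idempotent e_k whose tree has y-edges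
   exactly at 1 and x^k satisfies a e_k = a x^k e_k, while a finite set of such
   relations only allows finitely many displacements; hence the annihilator of a
   is not finitely generated. Replacing (A, a) by (a^-1 A, a^-1) exchanges the
   two sides.

   Positive half. A finite presentation over FLA is a prefix rewriting system on
   trees with a distinguished spine. Steps leaving at least t letters of the
   spine untouched only alter the part of the tree above the cut at distance t
   from the end within a finite window W, so that part of the state can be
   rewritten on its own and the rest is carried along unchanged. Cutting a
   derivation at its shortest untouched suffix leaves elements that can be
   reduced, letter by letter along the spine, to finitely many of them. *)
Require Import Defs.
From mathcomp Require Import all_boot finmap.
From mathcomp Require Import boolp classical_sets functions cardinality.

Set Implicit Arguments.
Unset Strict Implicit.
Unset Printing Implicit Defensive.

Local Open Scope classical_set_scope.
Local Open Scope group_scope.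

(** * Acts *)

Section Acts.
Variable S : monoidType.

Lemma cong_gen_congruence (A : ract S) (H : set (A * A)) :
  is_congruence (cong_gen H).
Proof.
split=> [a|a b ab|a b c ab bc|a b s ab] rho Hrho.
- exact: cong_refl (congP rho) a.
- by apply: (cong_sym (congP rho)); apply: ab.
- by apply: (cong_trans (congP rho)); [apply: ab | apply: bc].
- by apply: (cong_act (congP rho)); apply: ab.
Qed.

Definition cong_gen_cong (A : ract S) (H : set (A * A)) : congruence A :=
  Congruence (cong_gen_congruence H).

Lemma mem_cong_gen (A : ract S) (H : set (A * A)) c d :
  H (c, d) -> cong_gen H c d.
Proof. by move=> Hcd rho; apply. Qed.

Lemma quot_proj_eq (A : ract S) (rho : congruence A) a b :
  quot_proj rho a = quot_proj rho b <-> rho a b.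
Proof.
split=> [/(congr1 (@proj1_sig _ _)) /= e|ab]; last first.
  exact/quot_eq/cong_classP.
by have : cong_class rho b b; [exact: (cong_refl (congP rho)) | rewrite -e].
Qed.

Lemma fp_quot (n : nat) (rho : congruence (free_act S 'I_n)) :
  cong_fg rho -> finitely_presented (quot_act rho).
Proof.
move=> fg; exists n, rho; split=> //.
by exists id => //; exists id.
Qed.

(* The annihilator congruence of a generator of a finitely presented cyclic act
   is finitely generated, stated through the sets saturated by it. *)
Lemma fp_cyclic_annihilator (A : ract S) (c : A) :
  (forall a, exists s, a = actr c s) -> finitely_presented A ->
  exists H : set (S * S), [/\ finite_set H,
    forall p q, H (p, q) -> actr c p = actr c q &
    forall K : set S, (forall p q s, H (p, q) -> K (p * s) <-> K (q * s)) ->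
      forall u v, actr c u = actr c v -> K u <-> K v].
Proof.
move=> cgen [n [rho [[H' finH' rhoE] [F homF [F' FK F'K]]]]].
have homF' a s : F' (actr a s) = actr (F' a) s.
  by rewrite -{1}(F'K a) -homF FK.
pose gen (i : 'I_n) : A := F' (quot_proj rho (i, 1)).
have /choice[s sE] : forall i, exists s, gen i = actr c s.
  by move=> i; apply: cgen.
have [z zE] := quot_projE (F c).
case: z zE => m t zE.
have genE i u : F' (quot_proj rho (i, u)) = actr c (s i * u).
  rewrite actrM -sE /gen -homF'; congr F'.
  by rewrite [RHS]quot_actrE /= /free_actr /= mul1g.
(* The word [(m, t)] presents [c] itself, so [s m * t] fixes [c]. The pair [(s m * t, 1)] added to
   the translated relations lets one return from words over the [n] generators to words over [c]. *)
have cE : c = actr c (s m * t) by rewrite -genE -zE FK.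
pose phi (p : free_act S 'I_n * free_act S 'I_n) :=
  (s p.1.1 * p.1.2, s p.2.1 * p.2.2).
exists ((phi @` H') `|` [set (s m * t, 1)]); split.
- by rewrite finite_setU; split; [exact: finite_image | exact: finite_set1].
- move=> p q [[[[i u] [j v]] Huv [<- <-]]|[-> ->]] /=; last by rewrite actr1.
  rewrite -!genE; congr F'; apply/quot_proj_eq/rhoE.
  exact: mem_cong_gen.
- move=> K HK.
  (* Testing [K] on all right multiples [w] makes this a congruence. Saturation of [K] puts the
     pairs of [H'] into it, hence all of [rho]. *)
  have congK : @is_congruence S (free_act S 'I_n) (fun a b =>
      forall w, K (s a.1 * a.2 * w) <-> K (s b.1 * b.2 * w)).
    split=> //=.
    + by move=> a b ab w; split=> /ab.
    + by move=> a b d ab bd w; split=> [/ab/bd|/bd/ab].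
    + by move=> a b r ab w; rewrite !(mulgA (s _)) -!(mulgA _ r); apply: ab.
  move=> u v cuv.
  have /rhoE : rho (m, t * u) (m, t * v).
    apply/quot_proj_eq; rewrite -[LHS]F'K -[RHS]F'K !genE !mulgA.
    by rewrite !(actrM c (s m * t)) -cE cuv.
  move=> /(_ (Congruence congK)) /=; rewrite /= => /(_ _ 1).
  have mt w : K (s m * t * w) <-> K w.
    by rewrite -{2}[w]mul1g; apply: HK; right.
  rewrite !mulg1 !mulgA => h.
  apply: (iff_trans (iff_sym (mt u))); apply: iff_trans (mt v); apply: h.
  move=> [i p] [j q] Hpq w /=; apply: HK; left.
  by exists ((i, p), (j, q)).
Qed.

End Acts.

(** * Failure of coherency *)

(* [D s] is the tree of [s] and [d s] its end point; [dM] and [DM] reverse the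
   product of FIM, so [M] stands for the opposite of a monoid of pairs (A, a), or
   for the monoid itself read through (A, a) |-> (a^-1 A, a^-1). *)
Section NonCoherent.
Variables (M : monoidType) (G : groupType).
Variables (D : M -> set G) (d : M -> G) (x y : G) (xm f : M) (e : nat -> M).
Hypotheses (d1 : d 1 = 1) (dM : forall s t, d (s * t) = d t * d s).
Hypothesis D1 : forall g, D 1 g <-> g = 1.
Hypothesis DM :
  forall s t g, D (s * t) g <-> D t g \/ D s ((d t)^-1 * g).
Hypotheses (dx : d xm = x) (Dx : forall g, D xm g <-> g = 1 \/ g = x).
Hypotheses (df : d f = 1) (Df : forall g, D f g <-> g = 1 \/ g = y).
Hypotheses (de : forall k, d (e k) = 1).
Hypotheses (De : forall k g, D (e k) g ->
  (exists n, g = x ^+ n) \/ g = y \/ g = x ^+ k * y).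
Hypotheses (fe : forall k, f * e k = e k).
Hypothesis fxe : forall k, f * (xm ^+ k * e k) = xm ^+ k * e k.
Hypothesis x_inf : forall n, x ^+ n.+1 <> 1.
Hypothesis y_notin : forall i j, x ^+ i * y <> x ^+ j.

(** Adding the whole ray that starts at the end point makes the tree blind to sliding along [x],
    which is all that [B x = B] does. *)
Definition with_ray (s : M) : set G :=
  [set g | D s g \/ exists n, g = d s * x ^+ n].

Lemma with_rayM s t g :
  with_ray (s * t) g <-> D t g \/ with_ray s ((d t)^-1 * g).
Proof.
rewrite /with_ray /= dM; split=> [[/DM[]|[n ->]]|[Dt|[Ds|[n en]]]].
- by left.
- by right; left.
- by right; right; exists n; rewrite -mulgA mulKg.
- by left; apply/DM; left.
- by left; apply/DM; right.
- by right; exists n; rewrite -mulgA -en mulVKg.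
Qed.

Definition ray_equiv (s t : M) : Prop :=
  (exists i j, d s * x ^+ i = d t * x ^+ j) /\
  forall g, with_ray s g <-> with_ray t g.

Lemma ray_equivM s t r : ray_equiv s t -> ray_equiv (s * r) (t * r).
Proof.
move=> [[i [j ij]] st]; split.
  by exists i, j; rewrite !dM -!mulgA ij.
by move=> g; split=> /with_rayM[Dr|wr]; apply/with_rayM; (try by left);
  right; apply/st.
Qed.

Local Notation F2 := (free_act M 'I_2).
Local Notation A := (@ord0 1).
Local Notation B := (@ord_max 1).

(* The act is <A, B | A f = B f, B x = B>. *)
Definition relators : set (F2 * F2) :=
  [set ((A, f), (B, f)); ((B, xm), (B, 1))].

(** An upper bound for the presented congruence. The generator [A] can leave only through
    [A f = B f], so an element over [A] that is related to another one has a y-edge at its end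
    point. *)
Definition relator_inv (a b : F2) : Prop :=
  a = b \/ [/\ ray_equiv a.2 b.2,
    a.1 = A -> D a.2 (d a.2 * y) & b.1 = A -> D b.2 (d b.2 * y)].

Lemma relator_inv_congruence : is_congruence relator_inv.
Proof.
have DyM s r : D s (d s * y) -> D (s * r) (d (s * r) * y).
  by move=> Ds; apply/DM; right; rewrite dM -mulgA mulKg.
split.
- by move=> a; left.
- move=> a b [->|[[[i [j ij]] ab] Ha Hb]]; [by left|right; split=> //].
  by split=> [|g]; [exists j, i | split=> /ab].
- move=> a b c [->//|[[[i [j ij]] ab] Ha Hb]] [<-|[[[k [l kl]] bc] Hb' Hc]].
    by right; split=> //; split=> //; exists i, j.
  right; split=> //; split=> [|g]; last by split=> [/ab/bc|/bc/ab].
  exists (i + k)%N, (l + j)%N; rewrite !expgnDr !mulgA ij -kl.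
  by rewrite -!mulgA -!expgnDr addnC.
- move=> a b r [->|[ab Ha Hb]]; first by left.
  right; split=> /=; first exact: ray_equivM.
    by move=> /Ha; apply: DyM.
  by move=> /Hb; apply: DyM.
Qed.

Lemma relator_invP a b : cong_gen relators a b -> relator_inv a b.
Proof.
move=> /(_ (Congruence relator_inv_congruence)); apply=> c c' [[-> ->]|[-> ->]];
  right; split=> //=.
- by split=> //; exists 0, 0.
- by rewrite df mul1g => _; apply/Df; right.
split; first by exists 0, 1%N; rewrite dx d1 mulg1 mul1g expg1.
move=> g; rewrite /with_ray /= dx d1; split.
- move=> [/Dx[->|->]|[n ->]]; right.
  + by exists 0; rewrite mulg1.
  + by exists 1%N; rewrite mul1g expg1.
  + by exists n.+1; rewrite mul1g expgS.
- move=> [/D1->|[[|n] ->]]; rewrite ?mul1g.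
  + by left; apply/Dx; left.
  + by left; apply/Dx; left; rewrite expg0.
  + by right; exists n; rewrite expgS.
Qed.

Lemma expg_inj i j : x ^+ i = x ^+ j -> i = j.
Proof.
wlog ij : i j / (i <= j)%N.
  by move=> W; case: (leqP i j) => [/W//|/ltnW/W h /esym/h/esym].
move: ij => /subnK<-; rewrite expgnDr; case: (j - i)%N => // n.
by rewrite -[LHS]mul1g => /mulIg/esym/x_inf.
Qed.

(** If [p] and [q] differ, [q * s] has a y-edge at its end point, which is a quotient of powers of
    [x]. The tree of [e k] with its ray has y-edges only at 1 and [x ^+ k]. The end point is also
    the displacement [(d p)^-1 * d q], so it is not [x ^+ k] and must be 1. *)
Lemma annihilator_step k p q s :
  relator_inv (A, p) (A, q) -> (d p)^-1 * d q <> x ^+ k ->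
  d (p * s) = 1 -> (forall g, with_ray (p * s) g <-> with_ray (e k) g) ->
  d (q * s) = 1 /\ forall g, with_ray (q * s) g <-> with_ray (e k) g.
Proof.
case=> [[->]//|[/= pq Dp Dq] npq dps psE].
have [[i [j ij]] pqs] := ray_equivM s pq.
suff dqs : d (q * s) = 1.
  by split=> // g; split=> [/pqs/psE|/psE/pqs].
have : with_ray (e k) (d (q * s) * y).
  apply/psE/pqs; left; apply/DM; right.
  by rewrite dM -mulgA mulKg; apply: Dq.
rewrite /with_ray /= de => H.
have {}ij : x ^+ i = d (q * s) * x ^+ j by rewrite -ij dps mul1g.
have dqx : d (q * s) = (d p)^-1 * d q.
  have dsp : d s = (d p)^-1.
    by apply: (mulIg (d p)); rewrite -dM dps mulVg.
  by rewrite dM dsp.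
have qsE : d (q * s) = x ^+ i * (x ^+ j)^-1 by rewrite ij mulgK.
have comm : x ^+ i * (x ^+ j)^-1 = (x ^+ j)^-1 * x ^+ i.
  apply: (mulgI (x ^+ j)); rewrite mulVKg mulgA -expgnDr addnC expgnDr.
  by rewrite mulgK.
(* Powers of [x] commute, so the equation can be cleared of negative exponents before the hypotheses
   on [x] and [y] apply. *)
have key g : d (q * s) * y = g -> x ^+ i * y = x ^+ j * g.
  by move=> <-; rewrite qsE comm !mulgA mulgV mul1g.
case: H => [/De[[n /key]|[/key|/key]]|[n /key]].
- by rewrite -expgnDr => /y_notin.
- by move=> /mulIg xij; rewrite qsE xij mulgV.
- rewrite mulgA => /mulIg; rewrite -expgnDr => /expg_inj ijk.
  by case: npq; rewrite -dqx qsE comm ijk expgnDr mulKg.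
- by rewrite mul1g -expgnDr => /y_notin.
Qed.

(** In the subact generated by [A], a finite generating set [H] of the annihilator realises finitely
    many displacements [x ^+ k]. For any other positive [k] the set [K] is saturated by [H] but
    separates [e k] from [xm ^+ k * e k], which act alike on [A]. *)
Lemma ray_not_right_coherent : ~ right_coherent M.
Proof.
pose Q := quot_act (cong_gen_cong relators).
pose pr : F2 -> Q := quot_proj (cong_gen_cong relators).
have prM a s : actr (pr a) s = pr (actr a s) by apply: quot_actrE.
move=> coh.
have fpQ : finitely_presented Q.
  by apply: fp_quot; exists relators => //; exact: finite_set2.
have Ccl (a : Q) s : [set b | exists s, b = actr (pr (A, 1)) s] a ->
    [set b | exists s, b = actr (pr (A, 1)) s] (actr a s).
  by move=> [t ->]; exists (t * s); rewrite actrM.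
pose C := SubAct Ccl.
have fgC : subact_fg C.
  exists [set pr (A, 1)]; first exact: finite_set1.
  move=> b; split=> [[s ->]|[a [s [-> ->]]]]; last by exists s.
  by exists (pr (A, 1)), s.
have {coh fpQ fgC} fpC := coh _ fpQ _ fgC.
have C1 : subact_set C (pr (A, 1)) by exists 1; rewrite actr1.
pose c : act_of_subact C := exist _ _ C1.
have cgen a : exists s, a = actr c s.
  by case: a => a [s es]; exists s; apply: sub_eq.
have [H [finH Hann Hsat]] := fp_cyclic_annihilator cgen fpC.
have annE p q : actr c p = actr c q <-> cong_gen relators (A, p) (A, q).
  rewrite -[cong_gen _ _ _]/(cong_gen_cong relators (A, p) (A, q)).
  rewrite -quot_proj_eq.
  have E r : proj1_sig (actr c r) = pr (A, r).
    by rewrite /= -[quot_actr _ _]/(actr (pr (A, 1)) r) prM /actr /=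
      /free_actr /= mul1g.
  by split=> [/(congr1 (@proj1_sig _ _))|h]; [rewrite !E | apply: sub_eq;
    rewrite !E].
(* Both orders are excluded because [annihilator_step] is applied in both directions. *)
pose bad := [set k | exists2 p, H p & (d p.1)^-1 * d p.2 = x ^+ k] `|`
            [set k | exists2 p, H p & (d p.2)^-1 * d p.1 = x ^+ k].
have finbad (F : M * M -> G) :
    finite_set [set k | exists2 p, H p & F p = x ^+ k].
  have := finite_image F finH; set I := F @` H => finI.
  have : finite_set ((fun k => x ^+ k) @^-1` I).
    by apply: finite_preimage => // i j _ _; apply: expg_inj.
  by apply: sub_finite_set => k [p Hp Fp]; exists p.
(* Excluding 0 ensures [x ^+ k <> 1] at the end. *)
have finB : finite_set (bad `|` [set 0%N]).
  rewrite !finite_setU; split; last exact: finite_set1.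
  by split; apply: finbad.
have [k nk] : exists k, ~ (bad `|` [set 0%N]) k.
  apply: contrapT => h; apply: infinite_nat; apply: sub_finite_set finB.
  by move=> k _; apply: contrapT => nk; apply: h; exists k.
pose K := [set s | d s = 1 /\ forall g, with_ray s g <-> with_ray (e k) g].
have HK p q s : H (p, q) -> K (p * s) <-> K (q * s).
  move=> Hpq; have /relator_invP R := (annE p q).1 (Hann _ _ Hpq).
  have n1 : (d p)^-1 * d q <> x ^+ k.
    by move=> h; apply: nk; left; left; exists (p, q).
  have n2 : (d q)^-1 * d p <> x ^+ k.
    by move=> h; apply: nk; left; right; exists (p, q).
  split=> -[h1 h2]; first exact: annihilator_step h2.
  apply: annihilator_step h2 => //.
  exact: cong_sym relator_inv_congruence _ _ R.
(* The derivation is [A e_k = A f e_k = B e_k = B x^k e_k = A x^k e_k]. *)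
have uv : actr c (e k) = actr c (xm ^+ k * e k).
  have [re sy tr ac] := cong_gen_congruence relators.
  have step1 s : f * s = s -> cong_gen relators (A, s) (B, s).
    move=> fs; rewrite -fs; apply: (ac (A, f) (B, f) s).
    by apply: mem_cong_gen; left.
  have stepx n s : cong_gen relators (B, s) (B, xm ^+ n * s).
    elim: n s => [|n IH] s; first by rewrite expg0 mul1g; apply: re.
    apply: (tr _ _ _ (IH s)); rewrite expgS -mulgA.
    rewrite -{1}[xm ^+ n * s]mul1g; apply: sy; apply: (ac (B, xm) (B, 1)).
    by apply: mem_cong_gen; right.
  apply/annE; apply: (tr _ _ _ (step1 _ (fe k))); apply: (tr _ _ _ (stepx k _)).
  apply: sy.
  exact: step1.
have [dv _] : K (xm ^+ k * e k) by apply/(Hsat K HK _ _ uv).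
move: dv; rewrite dM de mul1g; case: k nk {K HK uv} => [|k] nk.
  by case: nk; right.
have dX n : d (xm ^+ n) = x ^+ n.
  by elim: n => // n IH; rewrite expgS dM IH dx expgSr.
by rewrite dX => /x_inf.
Qed.

End NonCoherent.

(** * Comb-shaped idempotents in submonoids of FIM *)

Section FIMNonCoherent.
Variable Omega : Type.
Local Notation FG := (FG Omega).
Local Notation FIM := (FIM Omega).
Local Notation letter := (letter Omega).

Definition fgl (l : letter) : FG := @MkFG _ [:: l] isT.

Lemma inv_letter_neq (l : letter) : l != inv_letter l.
Proof. by case: l => a b; rewrite xpair_eqE /= eqxx; case: b. Qed.

Lemma fglV l : (fgl l)^-1 = fgl (inv_letter l).
Proof. exact: val_inj. Qed.

Lemma word_fglX l n : word (fgl l ^+ n) = nseq n l.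
Proof.
elim: n => // n IH; rewrite expgS /= IH; case: n {IH} => //= n.
by rewrite (negPf (inv_letter_neq l)).
Qed.

Lemma word_fglXM l l' n : l.1 != l'.1 ->
  word (fgl l ^+ n * fgl l') = rcons (nseq n l) l'.
Proof.
move=> ll'; elim: n => [|n IH]; first by rewrite mul1g.
rewrite expgS -mulgA -[LHS]/(push l (word (fgl l ^+ n * fgl l'))) IH.
have nl : l' != inv_letter l by apply: contraNneq ll' => ->.
by case: n {IH} => [|n] /=; [rewrite (negPf nl)|
  rewrite (negPf (inv_letter_neq l))].
Qed.

Lemma fglX_neq1 l n : fgl l ^+ n.+1 <> 1.
Proof. by move=> /(congr1 (@word _)); rewrite word_fglX. Qed.

Lemma fglXM_neq l l' i j : l.1 != l'.1 -> fgl l ^+ i * fgl l' <> fgl l ^+ j.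
Proof.
move=> ll' /(congr1 (@word _)); rewrite word_fglXM // word_fglX => e.
have : l' \in nseq j l by rewrite -e mem_rcons mem_head.
by rewrite mem_nseq => /andP[_ /eqP l'l]; rewrite l'l eqxx in ll'.
Qed.

(** The tree of the idempotent [e_k]: a path of [k] edges [l] with an edge [l'] hanging at each of
    its two ends. *)
Definition comb (l l' : letter) (k : nat) : {fset FG} :=
  ([fset fgl l ^+ n | n in iota 0 k.+1] `|`
   [fset fgl l'; fgl l ^+ k * fgl l'])%fset.

Lemma mem_comb l l' k g : g \in comb l l' k <->
  (exists2 n, (n <= k)%N & g = fgl l ^+ n) \/
  g = fgl l' \/ g = fgl l ^+ k * fgl l'.
Proof.
rewrite !inE; split.
  case/or3P=> [/imfsetP[n nk ->]|/eqP->|/eqP->]; [|by auto|by auto].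
  left; exists n => //; move: nk.
  by rewrite -[_ \in _]/(n \in iota 0 k.+1) mem_iota.
case=> [[n nk ->]|[->|->]]; rewrite ?eqxx ?orbT //.
apply/orP; left; apply/imfsetP; exists n => //.
by rewrite -[_ \in _]/(n \in iota 0 k.+1) mem_iota.
Qed.

(** The letters have different bases, so [l^n l'] is reduced as written, and its proper prefixes are
    prefixes of [l^n]. *)
Lemma comb_prefix_closed l l' k : l.1 != l'.1 -> prefix_closed (comb l l' k).
Proof.
move=> ll'; apply/asboolP => u v uv.
have pX n : (n <= k)%N -> prefix u (fgl l ^+ n) -> u \in comb l l' k.
  move=> nk; rewrite word_fglX => /prefixP[w e]; apply/mem_comb; left.
  have ule : (size u <= n)%N by rewrite -[n](size_nseq n l) e size_cat leq_addr.
  exists (size u); first exact: leq_trans nk.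
  apply: val_inj; rewrite /= word_fglX.
  have := congr1 (take (size u)) e; rewrite take_size_cat // => eu.
  by rewrite -[LHS]eu take_nseq.
have pXM n : (n <= k)%N -> prefix u (fgl l ^+ n * fgl l') ->
    u = fgl l ^+ n * fgl l' \/ u \in comb l l' k.
  move=> nk; rewrite word_fglXM // => /prefixP[w]; case/lastP: w => [|w a] e.
    by left; apply: val_inj; rewrite -[LHS]cats0 -e -word_fglXM.
  right; apply: (pX n nk); rewrite word_fglX; apply/prefixP; exists w.
  by move: e; rewrite -rcons_cat => /rcons_inj[].
move=> /mem_comb[[n nk ev]|[ev|ev]]; move: uv; rewrite ev.
- exact: pX.
- rewrite -[fgl l']mul1g -(expg0 (fgl l)) => /pXM[] // ->.
  by apply/mem_comb; right; left; rewrite mul1g.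
- by move=> /pXM[] // ->; apply/mem_comb; right; right.
Qed.

Lemma in_FIM_comb l l' k : l.1 != l'.1 -> in_FIM (comb l l' k, 1).
Proof.
move=> ll'; apply/andP; split; first exact: comb_prefix_closed.
by apply/mem_comb; left; exists 0.
Qed.

Lemma in_FIM_edge l : in_FIM ([fset 1; fgl l]%fset, fgl l) &&
  in_FIM ([fset 1; fgl l]%fset, 1).
Proof.
rewrite /in_FIM /= !inE !eqxx orbT !andbT andbb; apply/asboolP => u v uv.
rewrite !inE => /orP[]/eqP ev; move: uv; rewrite ev /=.
  by case: u => [[|a u] ru] // _; apply/orP; left; apply/eqP/val_inj.
by case: u => [[|a [|b u]] ru] //= /andP[].
Qed.

Definition fim_gen l : FIM := MkFIM (proj1 (andP (in_FIM_edge l))).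
Definition fim_dom l : FIM := MkFIM (proj2 (andP (in_FIM_edge l))).

Lemma fim_mulP (p q : FIM) g : g \in (p * q).1 <->
  g \in p.1 \/ p.2^-1 * g \in q.1.
Proof.
rewrite inE; split=> [/orP[|/imfsetP[h /= hq ->]]|[->//|h]].
- by left.
- by right; rewrite mulKg.
by apply/orP; right; apply/imfsetP; exists (p.2^-1 * g); rewrite ?mulVKg.
Qed.

Lemma fim_mul2 (p q : FIM) : (p * q).2 = p.2 * q.2. Proof. by []. Qed.

Lemma fim_mem1 (p : FIM) : 1 \in p.1.
Proof. by have /andP[/prefix_closed1] := fim_pairP p; apply. Qed.

Lemma fim_eq (p q : FIM) : (forall g, g \in p.1 <-> g \in q.1) -> p.2 = q.2 ->
  p = q.
Proof.
case: p q => [[A a] hA] [[B b] hB] /= AB ab; apply: val_inj; congr pair => //=.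
by apply/fsetP => g; apply/idP/idP => /AB.
Qed.

Lemma fim_dom_mul l (p : FIM) : fgl l \in p.1 -> fim_dom l * p = p.
Proof.
move=> lp; apply: fim_eq => [g|]; last by rewrite fim_mul2 mul1g.
rewrite fim_mulP /= invg1 mul1g !inE; split; last by right.
by case=> // /orP[]/eqP-> //; apply: fim_mem1.
Qed.

Lemma fim_mul_dom l (p : FIM) : p.2 * fgl l \in p.1 -> p * fim_dom l = p.
Proof.
move=> lp; apply: fim_eq => [g|]; last by rewrite fim_mul2 mulg1.
rewrite fim_mulP /= !inE; split; last by left.
case=> // /orP[]/eqP h; last by rewrite -(mulVKg p.2 g) h.
by rewrite -(mulVKg p.2 g) h mulg1; have /andP[] := fim_pairP p.
Qed.

Lemma fim_genX2 l k : (fim_gen l ^+ k).2 = fgl l ^+ k.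
Proof. by elim: k => // k IH; rewrite !expgS fim_mul2 IH. Qed.

(** The embedding [j] allows FIM, FAM and FLA to be treated at once. *)
Variables (M : monoidType) (j : M -> FIM).
Hypotheses (j_inj : injective j) (j1 : j 1 = 1).
Hypothesis jM : forall s t, j (s * t) = j s * j t.
Variables (xm f : M) (e : nat -> M) (x y : Omega).
Hypothesis xy : ((x : {classic Omega}) != y).
Hypotheses (jx : j xm = fim_gen (x, true)) (jf : j f = fim_dom (y, true)).

Lemma jX k : j (xm ^+ k) = fim_gen (x, true) ^+ k.
Proof. by elim: k => // k IH; rewrite !expgS jM IH jx. Qed.

(** Left acts are right acts over the opposite monoid, whose product is already reversed, so trees
    and end points are used unchanged. *)
Lemma comb_not_left_coherent :
  (forall k, fim_pair (j (e k)) = (comb (x, true) (y, true) k, 1)) ->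
  ~ left_coherent M.
Proof.
move=> je; have e1 k := congr1 fst (je k); have e2 k := congr1 snd (je k).
have mX k : xm ^+ k = (xm : opposite M) ^+ k.
  by elim: k => // k IH; rewrite expgSr IH expgS.
apply: (@ray_not_right_coherent (opposite M) _ (fun s g => g \in (j s).1)
  (fun s => (j s).2) (fgl (x, true)) (fgl (y, true)) xm f e) => //=.
- by rewrite j1.
- by move=> s t; rewrite jM.
- by move=> g; rewrite j1 inE; split=> /eqP.
- by move=> s t g; rewrite jM fim_mulP.
- by rewrite jx.
- move=> g; rewrite jx !inE.
  by split=> [/orP[]/eqP|[]->]; rewrite ?eqxx ?orbT; auto.
- by rewrite jf.
- move=> g; rewrite jf !inE.
  by split=> [/orP[]/eqP|[]->]; rewrite ?eqxx ?orbT; auto.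
- move=> k g; rewrite e1 => /mem_comb[[n _ ->]|]; last by right.
  by left; exists n.
- move=> k; apply: j_inj; rewrite jM jf fim_mul_dom // e2 e1 mul1g.
  by apply/mem_comb; right; left.
- move=> k; rewrite -mX; apply: j_inj; rewrite !jM jf jX fim_mul_dom //.
  rewrite fim_mul2 e2 mul1g fim_genX2; apply/fim_mulP; left.
  by rewrite e1; apply/mem_comb; right; right.
- by move=> n; apply: fglX_neq1.
- by move=> i k; apply: fglXM_neq.
Qed.

(** Reading [(A, a)] as [(a^-1 A, a^-1)] reverses the product and turns the ray of [x] into that of
    [x^-1]. The combs now contain inverse letters, which FIM and FAM admit but FLA does not. *)
Lemma comb_not_right_coherent :
  (forall k, fim_pair (j (e k)) = (comb (x, false) (y, true) k, 1)) ->
  ~ right_coherent M.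
Proof.
move=> je; have e1 k := congr1 fst (je k); have e2 k := congr1 snd (je k).
apply: (@ray_not_right_coherent M _ (fun s g => (j s).2 * g \in (j s).1)
  (fun s => (j s).2^-1) (fgl (x, false)) (fgl (y, true)) xm f e) => //=.
- by rewrite j1 invg1.
- by move=> s t; rewrite jM fim_mul2 invgM.
- by move=> g; rewrite j1 mul1g inE; split=> /eqP.
- move=> s t g; rewrite jM fim_mulP fim_mul2 invgK -!mulgA mulKg.
  by split=> [[]|[]]; auto.
- by rewrite jx /= fglV.
- move=> g; rewrite jx /= !inE.
  have -> : fgl (x, false) = (fgl (x, true))^-1 by rewrite fglV.
  split=> [/orP[]/eqP h|[]->].
  + by right; apply: (mulgI (fgl (x, true))); rewrite h mulgV.
  + by left; apply: (mulgI (fgl (x, true))); rewrite h mulg1.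
  + by rewrite mulg1 eqxx orbT.
  + by rewrite mulgV eqxx.
- by rewrite jf invg1.
- move=> g; rewrite jf /= mul1g !inE.
  by split=> [/orP[]/eqP|[]->]; rewrite ?eqxx ?orbT; auto.
- by move=> k; rewrite e2 invg1.
- move=> k g; rewrite e1 e2 mul1g => /mem_comb[[n _ ->]|]; last by right.
  by left; exists n.
- move=> k; apply: j_inj; rewrite jM jf fim_dom_mul // e1.
  by apply/mem_comb; right; left.
- move=> k; apply: j_inj; rewrite !jM jf jX fim_dom_mul //.
  apply/fim_mulP; right; rewrite e1 fim_genX2 -expVgn fglV.
  by apply/mem_comb; right; right.
- by move=> n; apply: fglX_neq1.
- by move=> i k; apply: fglXM_neq.
Qed.

End FIMNonCoherent.

(** * The negative statements for FIM, FAM and FLA *)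

Section NegativeResults.
Variables (Omega : Type) (x y : Omega).
Hypothesis xy : x <> y.

Let xy' (b c : bool) :
  ((x, b) : letter Omega).1 != ((y, c) : letter Omega).1.
Proof. exact/eqP. Qed.

Definition fim_comb b k : FIM Omega :=
  MkFIM (@in_FIM_comb Omega (x, b) (y, true) k (xy' b true)).

Lemma FIM_not_left_coherent : ~ left_coherent (FIM Omega).
Proof.
apply: (@comb_not_left_coherent Omega (FIM Omega) id _ _ _
  (fim_gen (x, true)) (fim_dom (y, true)) (fim_comb true) x y) => //.
exact/eqP.
Qed.

Lemma FIM_not_right_coherent : ~ right_coherent (FIM Omega).
Proof.
apply: (@comb_not_right_coherent Omega (FIM Omega) id _ _ _
  (fim_gen (x, true)) (fim_dom (y, true)) (fim_comb false) x y) => //.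
exact/eqP.
Qed.

Definition fam_gen : FAM Omega :=
  @MkFAM _ (fim_gen (x, true)) isT.
Definition fam_dom : FAM Omega :=
  @MkFAM _ (fim_dom (y, true)) isT.
Definition fam_comb b k : FAM Omega := @MkFAM _ (fim_comb b k) isT.

Lemma FAM_not_left_coherent : ~ left_coherent (FAM Omega).
Proof.
apply: (@comb_not_left_coherent Omega (FAM Omega) (@fam_val _) _ _ _
  fam_gen fam_dom (fam_comb true) x y) => //; first exact: val_inj.
exact/eqP.
Qed.

Lemma FAM_not_right_coherent : ~ right_coherent (FAM Omega).
Proof.
apply: (@comb_not_right_coherent Omega (FAM Omega) (@fam_val _) _ _ _
  fam_gen fam_dom (fam_comb false) x y) => //; first exact: val_inj.
exact/eqP.
Qed.

Lemma in_FLA_edge z (p : FIM Omega) :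
  p.1 = [fset 1; fgl (z, true)]%fset -> in_FLA p.
Proof.
by move=> ep; apply/allP => g; rewrite ep !inE => /orP[]/eqP->.
Qed.

Definition fla_gen : FLA Omega :=
  MkFLA (@in_FLA_edge x (fim_gen (x, true)) erefl).
Definition fla_dom : FLA Omega :=
  MkFLA (@in_FLA_edge y (fim_dom (y, true)) erefl).

Lemma in_FLA_comb k : in_FLA (fim_comb true k).
Proof.
have pX n : positive (fgl (x, true) ^+ n).
  by elim: n => // n IH; rewrite expgS; apply: positiveM.
apply/allP => g /mem_comb[[n _ ->]|[->|->]] //.
exact: positiveM.
Qed.

Lemma FLA_not_left_coherent : ~ left_coherent (FLA Omega).
Proof.
apply: (@comb_not_left_coherent Omega (FLA Omega) (@fla_val _) _ _ _
  fla_gen fla_dom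
  (fun k => MkFLA (in_FLA_comb k)) x y) => //; first exact: val_inj.
exact/eqP.
Qed.

End NegativeResults.

(** * Right coherency of monoids of trees *)

Section FpFromKernel.
Variable S : monoidType.

Lemma fp_of_kernel (n : nat) (B : ract S) (psi : free_act S 'I_n -> B)
    (K : congruence (free_act S 'I_n)) :
  act_hom psi -> (forall b, exists p, psi p = b) ->
  (forall p q, psi p = psi q <-> K p q) -> cong_fg K -> finitely_presented B.
Proof.
move=> hpsi /choice[pre preK] kerE fgK; exists n, K; split=> //.
have /choice[rep repK] := @quot_projE S _ K.
exists (fun b => quot_proj K (pre b)).
  move=> b s; rewrite /= quot_actrE; apply/quot_proj_eq/kerE.
  by rewrite preK hpsi preK.
exists (fun C => psi (rep C)) => [b|C].
  by rewrite -[RHS]preK; apply/kerE/quot_proj_eq; rewrite -repK.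
by rewrite [RHS]repK; apply/quot_proj_eq/kerE; rewrite preK.
Qed.

End FpFromKernel.

(** * Finite prefix-closed trees of words with a marked end point *)

Section TreeMonoid.
Variables (S : monoidType) (L : Type) (D : S -> set (seq L)) (d : S -> seq L).
Hypothesis dM : forall s t, d (s * t) = d s ++ d t.
Hypothesis DM : forall s t w,
  D (s * t) w <-> D s w \/ exists2 v, D t v & w = d s ++ v.
Hypothesis tree_eq : forall s t, (forall w, D s w <-> D t w) -> d s = d t ->
  s = t.
Hypothesis tree_ex : forall (A : set (seq L)) a, finite_set A ->
  (forall u v, A (u ++ v) -> A u) -> A a -> exists s, D s = A /\ d s = a.
Hypothesis Dfin : forall s, finite_set (D s).
Hypothesis Dpre : forall s u v, D s (u ++ v) -> D s u.
Hypothesis Dd : forall s, D s (d s).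

(** An element is determined by its end point, which lies in [W], and by one bit for each word of
    [W]. *)
Lemma finite_trees (W : set (seq L)) : finite_set W ->
  finite_set [set s | D s `<=` W].
Proof.
move=> finW.
have /finite_seqP[l Wl] : @finite_set {classic seq L} W by [].
pose code s : (size l).-tuple bool * seq L :=
  (map_tuple (fun w => `[< D s w >]) (in_tuple l), d s).
rewrite -(@eq_finite_set _ _ (code @` [set s | D s `<=` W])).
  apply: (@sub_finite_set _ _ ([set: (size l).-tuple bool] `*` W)).
    by move=> _ [s sW <-]; split=> //; exact/sW/Dd.
  by apply: finite_setX => //; exact: finite_finset.
apply: inj_card_eq => s t /set_mem sW /set_mem tW [est ed].
apply: tree_eq => // w; suff h : W w -> D s w = D t w.
  by split=> Dw; move: (Dw); [rewrite h //; apply: sW|rewrite -h //; apply: tW].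
rewrite Wl /= => /(nthP (w : {classic seq L}))[i il <-].
have E r : nth false [seq `[< D r v >] | v <- l] i =
    `[< D r (nth (w : {classic seq L}) l i) >].
  exact: nth_map.
apply/propext; apply: asbool_eq_equiv; apply: etrans (esym (E s)) _.
by rewrite est; exact: E.
Qed.

Section Window.
(* [cut t s] and [tail t s] split the spine [d s] so that the tail has length
   [t]. [res t s] keeps, above the cut, only the part of the tree that lies in
   the window [W]; [sfx t s] is the rest, read from the cut. *)
Variable W : set (seq L).
Hypotheses (finW : finite_set W) (Wnil : W [::]).
Hypothesis Wfactor : forall u v, W (u ++ v) -> W u /\ W v.

Definition cut t s := take (size (d s) - t) (d s).
Definition tail t s := drop (size (d s) - t) (d s).

Lemma cut_tail t s : cut t s ++ tail t s = d s.
Proof. exact: cat_take_drop. Qed.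

Lemma size_tail t s : (t <= size (d s))%N -> size (tail t s) = t.
Proof. by move=> ts; rewrite size_drop subKn. Qed.

Lemma cutM t h r : (t <= size (d r))%N -> cut t (h * r) = d h ++ cut t r.
Proof.
move=> tr; rewrite /cut dM size_cat -addnBA // take_cat.
by rewrite ltnNge leq_addr /= addKn.
Qed.

Lemma tailM t h r : (t <= size (d r))%N -> tail t (h * r) = tail t r.
Proof.
move=> tr; rewrite /tail dM size_cat -addnBA // drop_cat.
by rewrite ltnNge leq_addr /= addKn.
Qed.

Definition res_set t s : set (seq L) :=
  [set w | D s w /\ forall e, w = cut t s ++ e -> W e].

(** The word [v] keeps the set prefix closed: a point inside the window stays if a branch leaves the
    window above it. *)
Definition sfx_set t s : set (seq L) :=
  [set e | (exists v, tail t s = e ++ v) \/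
           exists2 v, ~ W (e ++ v) & D s (cut t s ++ e ++ v)].

Lemma D_cut t s : D s (cut t s).
Proof. by apply: (@Dpre _ _ (tail t s)); rewrite cut_tail. Qed.

Lemma catI (u v w : seq L) : u ++ v = u ++ w -> v = w.
Proof. by elim: u => //= a u IH [/IH]. Qed.

Lemma res_ex t s : exists r, D r = res_set t s /\ d r = cut t s.
Proof.
apply: tree_ex.
- by apply: sub_finite_set (Dfin s) => w [].
- move=> u v [/Dpre Du h]; split=> // e ue.
  have /Wfactor[//] : W (e ++ v).
  by apply: h; rewrite ue catA.
- split; first exact: D_cut.
  by move=> e; rewrite -{1}[cut t s]cats0 => /catI <-.
Qed.

Lemma sfx_subD t s e : sfx_set t s e -> D s (cut t s ++ e).
Proof.
case=> [[v tv]|[v _]]; last by rewrite catA => /Dpre.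
by apply: (@Dpre _ _ v); rewrite -catA -tv cut_tail.
Qed.

Lemma sfx_ex t s : exists r, D r = sfx_set t s /\ d r = tail t s.
Proof.
apply: tree_ex.
- apply: (@sub_finite_set _ _ (drop (size (cut t s)) @` D s)).
    move=> e /sfx_subD De; exists (cut t s ++ e) => //.
    by rewrite drop_size_cat.
  exact/finite_image/Dfin.
- move=> u v [[w tw]|[w nW Dw]]; [left|right].
    by exists (v ++ w); rewrite tw catA.
  by exists (v ++ w); rewrite [u ++ _]catA.
- by left; exists [::]; rewrite cats0.
Qed.

Definition res t s : S := sval (cid (res_ex t s)).
Definition sfx t s : S := sval (cid (sfx_ex t s)).

Lemma D_res t s : D (res t s) = res_set t s.
Proof. by rewrite /res; case: cid => r []. Qed.
Lemma d_res t s : d (res t s) = cut t s.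
Proof. by rewrite /res; case: cid => r []. Qed.
Lemma D_sfx t s : D (sfx t s) = sfx_set t s.
Proof. by rewrite /sfx; case: cid => r []. Qed.
Lemma d_sfx t s : d (sfx t s) = tail t s.
Proof. by rewrite /sfx; case: cid => r []. Qed.

Lemma res_sfx t s : res t s * sfx t s = s.
Proof.
apply: tree_eq => [w|]; last by rewrite dM d_res d_sfx cut_tail.
rewrite DM D_res D_sfx d_res; split=> [[[]//|[v /sfx_subD ? ->]]//|Dw].
have [h|] := pselect (forall e, w = cut t s ++ e -> W e); first by left.
move=> /existsNP[e /not_implyP[we nWe]]; right; exists e => //.
by right; exists [::]; rewrite cats0 // -we.
Qed.

Section Prefixing.
Variables (t : nat) (h r : S).
Hypotheses (tr : (t <= size (d r))%N)
  (Wtop : forall e, D h (d h ++ e) -> W e).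

(** Whatever [h] contributes above the cut is a right factor of a word of [W], hence in the window,
    so truncation removes only branches of [r]. *)
Lemma res_mul : res t (h * r) = h * res t r.
Proof.
apply: tree_eq => [w|]; last by rewrite dM !d_res cutM.
rewrite DM !D_res /res_set /= cutM // DM; split.
- move=> [[Dh|[v Dv ->]] hW]; [by left|right; exists v => //; split=> // e ve].
  by apply: hW; rewrite ve catA.
- move=> [Dh|[v [Dv hW] ->]]; split=> //; [by left | | by right; exists v | ].
    by move=> e we; have [] := @Wfactor (cut t r) e _ => //; apply: Wtop;
      rewrite catA -we.
  by move=> e; rewrite -catA => /catI /hW.
Qed.

Lemma sfx_mul : sfx t (h * r) = sfx t r.
Proof.
apply: tree_eq => [w|]; last by rewrite !d_sfx tailM.
rewrite !D_sfx /sfx_set /= cutM // tailM //; split=> -[[v tv]|[v nW]];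
  try by left; exists v.
- move=> /DM[Dh|[u Du]]; last first.
    by rewrite -catA => /catI e; right; exists v => //; rewrite e.
  have [] := @Wfactor (cut t r) (w ++ v) _ => //; apply: Wtop.
  by rewrite catA.
- move=> Dr; right; exists v => //; apply/DM; right.
  by exists (cut t r ++ w ++ v) => //; rewrite -catA.
Qed.

End Prefixing.

Lemma res_top t s e : D (res t s) (d (res t s) ++ e) -> W e.
Proof. by rewrite D_res d_res => -[_]; apply. Qed.

(** This moves the cut by one letter along the spine; the second factor is the increment. *)
Lemma res_next t s : (t < size (d s))%N ->
  res t s = res t.+1 s * res t (sfx t.+1 s).
Proof.
move=> ts; rewrite -{1}(res_sfx t.+1 s) res_mul //; last exact: res_top.
by rewrite d_sfx size_tail.
Qed.

(** A cut inside a side of a relation leaves a piece of its spine, in [W], followed by branches in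
    [W]; hence products of two words. *)
Definition WW : set (seq L) := [set u ++ v | u in W & v in W].

Lemma finite_WW : finite_set WW.
Proof. exact: finite_image2. Qed.

Lemma sub_WW : W `<=` WW.
Proof. by move=> w Ww; exists [::] => //; exists w. Qed.

Definition small : set S := [set s | D s `<=` WW].

Lemma finite_small : finite_set small.
Proof. exact: finite_trees finite_WW. Qed.

Lemma res_all_small s : small (res (size (d s)) s).
Proof.
move=> w; rewrite D_res => -[_ h]; apply: sub_WW; apply: h.
by rewrite /cut subnn take0.
Qed.

Section Reached.
Variables (t : nat) (h r : S).
Hypotheses (tr : (size (d r) <= t)%N) (ths : (t <= size (d (h * r)))%N).
Hypothesis Wh : D h `<=` W.

(** The number of spine letters before the cut, all of them in [h]. *)
Let k := (size (d h) + size (d r) - t)%N.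
Let kh : (k <= size (d h))%N.
Proof. by rewrite /k leq_subLR addnC leq_add2r. Qed.

Lemma cut_reached : cut t (h * r) = take k (d h).
Proof.
rewrite /cut dM size_cat -/k take_cat; case: ltnP => // h1.
have -> : k = size (d h) by apply/eqP; rewrite eqn_leq kh h1.
by rewrite subnn take0 cats0 take_size.
Qed.

Let dhE : d h = cut t (h * r) ++ drop k (d h).
Proof. by rewrite cut_reached cat_take_drop. Qed.

Lemma res_reached : small (res t (h * r)).
Proof.
move=> w; rewrite D_res => -[/DM[/Wh/sub_WW //|[v Dv wE]] hW].
exists (cut t (h * r)).
  by have /Wh := Dd h; rewrite dhE => /Wfactor[].
exists (drop k (d h) ++ v); last by rewrite catA -dhE wE.
by apply: hW; rewrite catA -dhE.
Qed.

(** The next spine letter [x] still belongs to [h]. Branches of [h] over the cut stay in [W], so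
    anything kept by [sfx] outside the window comes from [r] and starts with [x]; past [x], [res]
    truncates to [W]. *)
Lemma sfx_reached t' : t = t'.+1 -> (size (d r) < t)%N ->
  small (res t' (sfx t (h * r))).
Proof.
move=> tE rt.
have kh' : (k < size (d h))%N.
  rewrite -(ltn_add2r t) subnK ?ltn_add2l //.
  by rewrite -size_cat -dM.
case q : (drop k (d h)) => [|x q'].
  by move: kh'; rewrite -subn_gt0 -size_drop q.
have tlE : tail t (h * r) = x :: q' ++ d r.
  apply: (@catI (cut t (h * r))).
  by rewrite cut_tail dM {1}dhE q -catA.
have cutE : cut t' (sfx t (h * r)) = [:: x].
  rewrite /cut d_sfx size_tail // tE subSnn -tE tlE /=.
  by rewrite take0.
have Wx : W [:: x].
  have /Wh := Dd h; rewrite dhE q => /Wfactor[_].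
  by rewrite -cat1s => /Wfactor[].
move=> w; rewrite D_res /res_set /= cutE D_sfx => -[sw hW].
have xe a e : a :: e = w -> a = x -> WW w.
  move=> aw ax; exists [:: x] => //; exists e; last by rewrite -aw ax.
  by apply: hW; rewrite -aw ax.
case: sw xe => [[v]|[v nW]].
  rewrite tlE; case: w hW => [|a e] hW; first by move=> *; exact: sub_WW.
  by move=> [<- _] /(_ _ _ erefl erefl).
move=> /DM[/Wh/Wfactor[_ /nW //]|[u _]].
rewrite {1}dhE -catA => /catI; rewrite q.
case: w hW {nW} => [|a e] hW; first by move=> *; exact: sub_WW.
by move=> [-> _] /(_ _ _ erefl erefl).
Qed.

End Reached.

(** * Finite generation of the kernel congruence *)

Section Kernel.
Variables (n m : nat).
Local Notation Fn := (free_act S 'I_n).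
Local Notation Fm := (free_act S 'I_m).
Variables (H : set (Fn * Fn)) (b : 'I_m -> Fn).

(* [side h] holds of the two sides of the pairs of [H] and of the images of the
   free generators; the latter make the two ends of a chain count as steps. *)
Definition side : set Fn :=
  [set h | (exists h', H (h, h') \/ H (h', h)) \/ exists i, h = b i].

Hypothesis Wside : forall h, side h -> D h.2 `<=` W.

(** Derivations whose every step leaves at least [t] spine letters untouched, in the right factor
    [r]; [chain 0] imposes no bound. *)
Inductive chain (t : nat) : Fn -> Fn -> Prop :=
| chain_refl a : chain t a a
| chain_step h h' r c : H (h, h') \/ H (h', h) -> (t <= size (d r))%N ->
    chain t (actr h' r) c -> chain t (actr h r) c.

Lemma chain_trans t a c e : chain t a c -> chain t c e -> chain t a e.
Proof.
by elim=> {a c} [//|h h' r c hh' tr _ IH] /IH; apply: chain_step.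
Qed.

Lemma chain_sym t a c : chain t a c -> chain t c a.
Proof.
elim=> {a c} [a|h h' r c hh' tr _ IH]; first exact: chain_refl.
apply: chain_trans IH _; apply: (@chain_step t h' h) => //; last first.
  exact: chain_refl.
by case: hh'; [right|left].
Qed.

Lemma chain_weaken t t' a c : (t' <= t)%N -> chain t a c -> chain t' a c.
Proof.
move=> tt'; elim=> {a c} [a|h h' r c hh' tr _ IH]; first exact: chain_refl.
by apply: chain_step IH => //; apply: leq_trans tr.
Qed.

Lemma chain_congruence : is_congruence (chain 0).
Proof.
split; [exact: chain_refl|exact: chain_sym|exact: chain_trans|].
move=> a c s; elim=> {a c} [a|h h' r c hh' tr _ IH]; first exact: chain_refl.
by rewrite -actrM; apply: (@chain_step 0 h h') => //; rewrite actrM.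
Qed.

Lemma cong_gen_chain a c : cong_gen H a c -> chain 0 a c.
Proof.
move=> /(_ (Congruence chain_congruence)); apply=> h h' hh'.
rewrite -[h]actr1 -[h']actr1.
by apply: (@chain_step 0 h h'); [left| |exact: chain_refl].
Qed.

Definition at_tail (l : nat) (a : Fn) : Prop :=
  exists h r, [/\ side h, a = actr h r & size (d r) = l].

Lemma chain_min_tail a c la lc : chain 0 a c -> at_tail la a -> at_tail lc c ->
  exists l w, [/\ (l <= la)%N, (l <= lc)%N, at_tail l w, chain l a w &
    chain l w c].
Proof.
move=> ac; elim: ac la => {a c} [a|h h' r c hh' _ _ IH] la Ha Hc.
  have [lac|/ltnW lca] := leqP la lc.
    by exists la, a; split=> //; exact: chain_refl.
  by exists lc, a; split=> //; exact: chain_refl.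
have Sh' : side h' by left; exists h; case: hh'; auto.
have [|l [w [lr llc wl hw wc]]] := IH (size (d r)) _ Hc.
  by exists h', r.
have rw : chain l (actr h r) w by exact: (chain_step hh').
have [lla|/ltnW lal] := leqP l la; first by exists l, w.
exists la, (actr h r); split=> //.
- exact: leq_trans lal llc.
- exact: chain_refl.
- exact: chain_weaken lal (chain_trans rw wc).
Qed.

(** Stop just before the first step that leaves fewer than [t] letters, or at [w] if there is
    none. *)
Lemma chain_first_hit t a w l : chain 0 a w -> at_tail l w -> (l < t)%N ->
  exists w' l', [/\ at_tail l' w', (l' < t)%N & chain t a w'].
Proof.
move=> aw; elim: aw => {a w} [a|h h' r c hh' _ _ IH] Hw lt.
  by exists a, l; split=> //; exact: chain_refl.
have Sh : side h by left; exists h'; case: hh'; auto.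
have [tr|rt] := leqP t (size (d r)).
  have [w' [l' [Hw' l't h'w']]] := IH Hw lt.
  by exists w', l'; split=> //; exact: (chain_step hh').
exists (actr h r), (size (d r)); split=> //; last exact: chain_refl.
by exists h, r.
Qed.

Lemma side_top h e : side h -> D h.2 (d h.2 ++ e) -> W e.
Proof. by move=> /Wside hW /hW /Wfactor[]. Qed.

Definition resa t (a : Fn) : Fn := (a.1, res t a.2).

Lemma resa_act t h r : side h -> (t <= size (d r))%N ->
  resa t (actr h r) = actr h (res t r).
Proof.
move=> Sh tr; rewrite /resa /= /free_actr /= res_mul // => e.
exact: side_top.
Qed.

Lemma sfx_act t (h : Fn) r : side h -> (t <= size (d r))%N ->
  sfx t (actr h r).2 = sfx t r.
Proof. by move=> Sh tr; rewrite /= sfx_mul // => e; exact: side_top. Qed.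

(** By [res_mul] each step acts on the residue through the same relation, and by [sfx_mul] it leaves
    the suffix alone. *)
Lemma chain_res t a c : chain t a c ->
  cong_gen H (resa t a) (resa t c) /\ sfx t a.2 = sfx t c.2.
Proof.
have [re sy tr ac] := cong_gen_congruence H.
elim=> {a c} [a|h h' r c hh' tsr _ [IH1 IH2]]; first by split.
have Sh : side h by left; exists h'; case: hh'; auto.
have Sh' : side h' by left; exists h; case: hh'; auto.
split; last by rewrite -IH2 !sfx_act.
apply: (tr _ _ _ _ IH1); rewrite !resa_act //; apply: ac.
by case: hh' => hh'; [|apply: sy]; apply: mem_cong_gen.
Qed.

Lemma chain_size t a c : chain t a c -> (t <= size (d a.2))%N ->
  (t <= size (d c.2))%N.
Proof.
elim=> {a c} [//|h h' r c _ tr _ IH] _; apply: IH.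
by rewrite /= dM size_cat (leq_trans tr) // leq_addl.
Qed.

Definition phi (p : Fm) : Fn := actr (b p.1) p.2.

Lemma phi_act p s : phi (actr p s) = actr (phi p) s.
Proof. by rewrite /phi actrM. Qed.

Definition ker_rel (p q : Fm) : Prop := cong_gen H (phi p) (phi q).

Lemma ker_congruence : is_congruence ker_rel.
Proof.
have [re sy tr ac] := cong_gen_congruence H.
split=> [p|p q|p q r|p q s pq]; [exact: re|exact: sy|exact: tr|].
by rewrite /ker_rel !phi_act; apply: ac.
Qed.

Definition kerK : congruence Fm := Congruence ker_congruence.

Lemma side_b i : side (b i). Proof. by right; exists i. Qed.

Lemma at_tail_phi p : at_tail (size (d p.2)) (phi p).
Proof. by exists (b p.1), p.2; split=> //; exact: side_b. Qed.

Lemma phi_res t (p : Fm) : (t <= size (d p.2))%N ->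
  phi (p.1, res t p.2) = resa t (phi p).
Proof. by move=> tp; rewrite resa_act //; exact: side_b. Qed.

Definition small_act k : set (free_act S 'I_k) := [set a | small a.2].

Lemma finite_small_act k : finite_set (@small_act k).
Proof.
have := finite_setX (@finite_finset _ [set: 'I_k]) finite_small.
by apply: sub_finite_set => a sa; split.
Qed.

Lemma at_tail_small t l (a : Fn) : at_tail l a -> (l <= t <= size (d a.2))%N ->
  small_act (resa t a).
Proof.
move=> [h [r [Sh -> <-]]] /andP[rt ta].
by rewrite /small_act /=; apply: res_reached => //; apply: Wside.
Qed.

Lemma at_tail_sfx_small t l (a : Fn) : at_tail l a ->
  (l <= t < size (d a.2))%N -> small (res t (sfx t.+1 a.2)).
Proof.
move=> [h [r [Sh -> <-]]] /andP[rt ta].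
by apply: sfx_reached => //; first exact: leqW; apply: Wside.
Qed.

(** One preimage is chosen for each of the finitely many small elements congruent to a value of
    [phi]. *)
Lemma representatives : exists Z : set Fm, finite_set Z /\
  forall a p, small_act a -> cong_gen H a (phi p) ->
    exists2 z, Z z & cong_gen H a (phi z).
Proof.
have /choice[f fE] : forall a : Fn, exists o : option Fm,
    if o is Some z then cong_gen H a (phi z)
    else forall p, ~ cong_gen H a (phi p).
  move=> a; have [[z az]|nz] := pselect (exists z, cong_gen H a (phi z)).
    by exists (Some z).
  by exists None => p ap; apply: nz; exists p.
exists (Some @^-1` (f @` @small_act n)); split.
  apply: finite_preimage; first by move=> ? ? _ _ [].
  exact/finite_image/finite_small_act.
move=> a p sa ap; have := fE a; case fa : (f a) => [z|]; last by move/(_ p).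
by move=> az; exists z => //; exists a.
Qed.

Lemma kernel_fg : cong_fg kerK.
Proof.
have [Z [finZ ZP]] := representatives.
(* These are the elements met by the descent: representatives, representatives extended by one
   increment, and residues cut at the start of the spine. *)
pose Z' : set Fm := Z `|` [set actr z g | z in Z & g in small] `|` @small_act m.
have finZ' : finite_set Z'.
  rewrite !finite_setU; split; last exact: finite_small_act.
  by split=> //; apply: finite_image2 => //; exact: finite_small.
pose G : set (Fm * Fm) := [set p | [/\ ker_rel p.1 p.2, Z' p.1 & Z' p.2]].
exists G.
  have := finite_setX finZ' finZ'.
  by apply: sub_finite_set => p [_ h1 h2]; split.
have [re sy tr ac] := cong_gen_congruence H.
have [Gre Gsy Gtr Gac] := cong_gen_congruence G.
have GK p q : cong_gen G p q -> ker_rel p q by move=> /(_ kerK); apply=> c e [].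
have GZ z z' : Z z -> Z z' -> ker_rel z z' -> cong_gen G z z'.
  by move=> Zz Zz' zz'; apply: mem_cong_gen; split=> //=; left; left.
(* Induction on [j] moves the cut from the start of the spine of [p] to distance [l] from its end,
   reducing the residue to an element of [Z] at each letter. *)
have descent (p : Fm) w l : chain 0 (phi p) w -> at_tail l w ->
    forall j, (l + j <= size (d p.2))%N ->
    forall t, t = (size (d p.2) - j)%N -> forall a, small_act a ->
    cong_gen H a (phi (p.1, res t p.2)) ->
    exists z, [/\ Z z, cong_gen H a (phi z) & cong_gen G (p.1, res t p.2) z].
  move=> pw wl; elim=> [|j IH] lj t tE a sa ap.
    have [z Zz az] := ZP _ _ sa ap; exists z; split=> //.
    apply: mem_cong_gen; split=> /=; last by left; left.
      exact: (tr _ _ _ (sy _ _ ap) az).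
    by right; rewrite /small_act /= tE subn0; exact: res_all_small.
  have jp : (j < size (d p.2))%N.
    by apply: leq_trans lj; rewrite addnS ltnS leq_addl.
  have tS : t.+1 = (size (d p.2) - j)%N by rewrite tE -subSn.
  have tp : (t < size (d p.2))%N by rewrite tS leq_subr.
  have lt : (l <= t)%N by rewrite tE leq_subRL 1?addnC // ltnW.
  (* Up to [w'] the last [t.+1] letters are untouched, so the residues there are congruent and the
     suffixes equal. At [w'] a side reaches past the cut, which makes the residue and the next
     increment small. *)
  have [w' [l' [w'l' l't pw']]] := chain_first_hit pw wl (lt : (l < t.+1)%N).
  have [res_pw sfx_pw] := chain_res pw'.
  have tphi : (t.+1 <= size (d (phi p).2))%N.
    by rewrite /= dM size_cat (leq_trans tp) // leq_addl.
  have tw' := chain_size pw' tphi.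
  have sw' : small_act (resa t.+1 w').
    by apply: at_tail_small w'l' _; rewrite ltnW.
  have gs : small (res t (sfx t.+1 p.2)).
    have := @at_tail_sfx_small t _ _ w'l'; rewrite -sfx_pw sfx_act //;
      last exact: side_b.
    by apply; rewrite tw' andbT -ltnS.
  have [] := IH _ t.+1 tS (resa t.+1 w') sw' _.
  - by apply: leq_trans lj; rewrite leq_add2l.
  - by rewrite phi_res //; apply: sy.
  move=> z [Zz wz pz].
  have [z' Zz' az'] := ZP _ _ sa ap; exists z'; split=> //.
  set g := res t _ in gs.
  have pg : (p.1, res t p.2) = @actr S Fm (p.1, res t.+1 p.2) g.
    by rewrite /= /free_actr /= -res_next.
  have pzg : cong_gen G (p.1, res t p.2) (actr z g) by rewrite pg; apply: Gac.
  apply: (Gtr _ _ _ pzg); apply: mem_cong_gen; split=> /=.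
  - apply: (tr _ _ _ _ az'); apply: (tr _ _ _ _ (sy _ _ ap)).
    exact: sy (GK _ _ pzg).
  - by left; right; exists z => //; exists g.
  - by left; left.
move=> p q; split; last exact: GK.
move=> /cong_gen_chain pq.
(* Cut at the shortest untouched suffix, [p] and [q] share the same [sfx l], and their residues
   reduce to related elements of [Z]. *)
have [l [w [lp lq wl pw wq]]] :=
  chain_min_tail pq (at_tail_phi p) (at_tail_phi q).
have wp := chain_sym wq.
have lphi (e : Fm) : (l <= size (d e.2))%N -> (l <= size (d (phi e).2))%N.
  by move=> le; rewrite /= dM size_cat (leq_trans le) // leq_addl.
have sw : small_act (resa l w).
  apply: at_tail_small wl _; rewrite leqnn.
  exact: chain_size pw (lphi _ lp).
have tailE (e : Fm) : (l <= size (d e.2))%N -> chain l (phi e) w ->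
    sfx l e.2 = sfx l w.2 /\
    exists z, [/\ Z z, cong_gen H (resa l w) (phi z) &
      cong_gen G (e.1, res l e.2) z].
  move=> le ew; have [rew sew] := chain_res ew.
  rewrite -sew sfx_act //; last exact: side_b.
  split=> //; apply: (descent e w l (chain_weaken (leq0n l) ew) wl
    (size (d e.2) - l)%N) => //; rewrite ?subnKC ?subKn //.
  by rewrite phi_res //; apply: sy.
have [sp [z [Zz wz pz]]] := tailE p lp pw.
have [sq [z' [Zz' wz' qz']]] := tailE q lq wp.
have pE (e : Fm) : e = @actr S Fm (e.1, res l e.2) (sfx l e.2).
  by rewrite /= /free_actr /= res_sfx; case: e.
rewrite (pE p) (pE q) sp sq; apply: Gac.
apply: (Gtr _ _ _ pz); apply: (Gtr _ _ _ _ (Gsy _ _ qz')).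
by apply: GZ => //; apply: (tr _ _ _ _ wz'); apply: sy.
Qed.

End Kernel.

End Window.

Lemma tree_right_coherent : right_coherent S.
Proof.
move=> A [n [rho [[H finH rhoE] [F homF [F' FK F'K]]]]] B [X finX BX].
have /finite_seqP[l Xl] : @finite_set {classic A} X by [].
pose m := size l.
have XB x : X x -> subact_set B x.
  by move=> Xx; apply/BX; exists x, 1; rewrite actr1.
pose x (i : 'I_m) : A := tnth (in_tuple l) i.
have Xx i : X (x i) by rewrite Xl; exact: mem_tnth.
have xX a : X a -> exists i, x i = a.
  by rewrite Xl => /(tnthP (in_tuple l))[i ->]; exists i.
have /choice[b bE] : forall i, exists p, F (x i) = quot_proj rho p.
  by move=> i; apply: quot_projE.
(* All factors of words in the trees of the sides; suffixes suffice since the trees are prefix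
   closed. *)
pose W : set (seq L) := [set [::]] `|`
  [set e | exists h u, side H b h /\ D h.2 (u ++ e)].
have finside : finite_set (side H b).
  have : finite_set ((fst @` H `|` snd @` H) `|` range b).
    rewrite !finite_setU; split; last exact/finite_image/finite_finset.
    by split; exact: finite_image.
  apply: sub_finite_set => h [[h' [hh'|h'h]]|[i ->]].
  - by left; left; exists (h, h').
  - by left; right; exists (h', h).
  - by right; exists i.
have finW : finite_set W.
  rewrite finite_setU; split; first exact: finite_set1.
  have : finite_set (\bigcup_(h in side H b) \bigcup_(w in D h.2)
      [set drop i w | i in `I_(size w).+1]).
    apply: bigcup_finite => // h _; apply: bigcup_finite => // w _.
    exact/finite_image/finite_II.
  apply: sub_finite_set => e [h [u [Sh De]]]; exists h => //.
  exists (u ++ e) => //; exists (size u); last by rewrite drop_size_cat.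
  by rewrite /= size_cat ltnS leq_addr.
have Wnil : W [::] by left.
have Wfactor u v : W (u ++ v) -> W u /\ W v.
  case=> [|[h [w [Sh De]]]]; first by case: u => // e; split=> //; left.
  split; right; exists h; last by exists (w ++ u); rewrite -catA.
  by exists w; split=> //; apply: (@Dpre _ _ v); rewrite -catA.
have Wside h : side H b h -> D h.2 `<=` W.
  by move=> Sh w Dw; right; exists h, [::].
have fgK := kernel_fg finW Wnil Wfactor Wside.
have psiB (p : free_act S 'I_m) : subact_set B (actr (x p.1) p.2).
  exact/subact_closed/XB.
pose psi p : act_of_subact B := exist _ _ (psiB p).
apply: (@fp_of_kernel _ m _ psi _ _ _ _ fgK).
- by move=> p s; apply: sub_eq; rewrite /= actrM.
- move=> [a Ba]; have /BX[y [s [/xX[i xy] ay]]] := Ba.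
  by exists (i, s); apply: sub_eq; rewrite /= xy ay.
have FE p : F (actr (x p.1) p.2) = quot_proj rho (phi b p).
  by rewrite homF bE [LHS]quot_actrE.
move=> p q; apply: (@iff_trans _ (rho (phi b p) (phi b q))); last exact: rhoE.
rewrite -quot_proj_eq -!FE; split=> [[->]//|e].
by apply: sub_eq; rewrite /= -[LHS]FK -[RHS]FK e.
Qed.

End TreeMonoid.

(** * FLA as a monoid of trees of positive words *)

Section FLACoherent.
Variable Omega : Type.
Local Notation FG := (FG Omega).
Local Notation FLA := (FLA Omega).

Lemma reduced_pos (w : seq Omega) :
  reduced [seq (x : {classic Omega}, true) | x <- w].
Proof. by elim: w => // x [|y w] //= ->; rewrite xpair_eqE andbF. Qed.

Definition pos (w : seq Omega) : FG := MkFG (reduced_pos w).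
Definition unpos (g : FG) : seq Omega := [seq l.1 | l <- word g].

Lemma posK : cancel pos unpos.
Proof. by move=> w; rewrite /unpos /= -map_comp map_id. Qed.

Lemma unposK g : positive g -> pos (unpos g) = g.
Proof.
rewrite /positive => pg; apply: val_inj; rewrite /= /unpos -map_comp.
by elim: (word g) pg => //= -[x c] w IH /= /andP[-> /IH ->].
Qed.

(** Two positive letters are never mutually inverse, so nothing cancels. *)
Lemma posD u v : pos (u ++ v) = pos u * pos v.
Proof.
apply: val_inj => /=; elim: u => //= x u <-.
by case: (u ++ v) => [|y w] //=; rewrite xpair_eqE andbF.
Qed.

Definition flaD (s : FLA) : set (seq Omega) := [set w | pos w \in s.1].
Definition flad (s : FLA) : seq Omega := unpos s.2.

Lemma fla_positive (s : FLA) g : g \in s.1 -> positive g.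
Proof. by move=> gs; have /allP := fla_valP s; apply. Qed.

Lemma fla_end (s : FLA) : s.2 \in s.1.
Proof. by have /andP[] := fim_pairP s. Qed.

Lemma pos_flad s : pos (flad s) = s.2.
Proof. exact/unposK/fla_positive/fla_end. Qed.

Lemma flad_mul s t : flad (s * t) = flad s ++ flad t.
Proof.
by apply: (can_inj posK); rewrite posD !pos_flad.
Qed.

Lemma flaD_mul s t w :
  flaD (s * t) w <-> flaD s w \/ exists2 v, flaD t v & w = flad s ++ v.
Proof.
apply: (iff_trans (fim_mulP _ _ _)); split=> -[ws|]; try by left.
- move=> wt; right; exists (unpos ((fla_val s).2^-1 * pos w)).
    by rewrite /flaD /= unposK //; apply: fla_positive wt.
  apply: (can_inj posK); rewrite posD pos_flad unposK ?mulVKg //.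
  exact: fla_positive wt.
- by case=> v vt ->; right; rewrite posD pos_flad mulKg.
Qed.

Lemma fla_eq s t : (forall w, flaD s w <-> flaD t w) -> flad s = flad t ->
  s = t.
Proof.
move=> st dst; apply: val_inj; apply: fim_eq => [g|]; last first.
  by rewrite -!pos_flad dst.
by split=> gs; move: (gs); rewrite -(unposK (fla_positive gs)) => /st.
Qed.

Lemma fla_ex (A : set (seq Omega)) a : finite_set A ->
  (forall u v, A (u ++ v) -> A u) -> A a -> exists s, flaD s = A /\ flad s = a.
Proof.
move=> finA Apre Aa; have finpA := finite_image pos finA.
pose B : {fset FG} := fset_set (pos @` A).
have BP g : g \in B <-> exists2 w, A w & pos w = g.
  by rewrite in_fset_set // inE.
have inB : in_FIM (B, pos a).
  apply/andP; split; last by apply/BP; exists a.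
  apply/asboolP => u v /prefixP[w vE] /BP[c Ac cv]; apply/BP.
  have cE : c = unpos u ++ [seq l.1 | l <- w].
    by rewrite -[c]posK cv /unpos vE map_cat.
  exists (unpos u); first by apply: (Apre _ [seq l.1 | l <- w]); rewrite -cE.
  apply: unposK; have : positive v.
    by rewrite -cv /positive /= all_map; apply/allP.
  by rewrite /positive vE all_cat => /andP[].
have inF : in_FLA (MkFIM inB).
  apply/allP => g /BP[w _ <-].
  by rewrite /positive /= all_map; apply/allP.
exists (MkFLA inF); split; last exact: posK.
apply/seteqP; split=> w; rewrite /flaD /=.
  by move=> /BP[v Av /(can_inj posK) <-].
by move=> Aw; apply/BP; exists w.
Qed.

Lemma FLA_right_coherent : right_coherent FLA.
Proof.
apply: (tree_right_coherent flad_mul flaD_mul fla_eq fla_ex).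
- move=> s; apply: (@sub_finite_set _ _ (unpos @` [set` (fla_val s).1])).
    by move=> w ws; exists (pos w) => //; exact: posK.
  exact/finite_image/finite_fset.
- move=> s u v /= uvs; have /andP[/asboolP cA _] := fim_pairP s.
  by apply: cA uvs; rewrite /= map_cat prefix_prefix.
- by move=> s; rewrite /flaD /= pos_flad fla_end.
Qed.

End FLACoherent.

Theorem theorem7p5 (Omega : Type) (hOmega : exists x y : Omega, x <> y) :
  (~ left_coherent (FIM Omega) /\ ~ right_coherent (FIM Omega)) /\
  (~ left_coherent (FAM Omega) /\ ~ right_coherent (FAM Omega)) /\
  (right_coherent (FLA Omega) /\ ~ left_coherent (FLA Omega)).
Proof.
have [x [y xy]] := hOmega.
split; [|split]; split.
- exact: FIM_not_left_coherent xy.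
- exact: FIM_not_right_coherent xy.
- exact: FAM_not_left_coherent xy.
- exact: FAM_not_right_coherent xy.
- exact: FLA_right_coherent.
- exact: FLA_not_left_coherent xy.
Qed.
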